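(* For integers $p\ge 1$ and $n\ge 1$, let $s_p^n$ denote the number of $n$-plexes of order $p$ up to isomorphism (equivalently, the number of isomorphism classes of $(n+1)$-uniform hypergraphs on $p$ vertices). Then for $1\le p\le 9$ and $n=1,2,3$ the values of $s_p^n$ are as follows. For $n=1$: $s_1^1=1$, $s_2^1=2$, $s_3^1=4$, $s_4^1=11$, $s_5^1=34$, $s_6^1=156$, $s_7^1=1044$, $s_8^1=12346$, $s_9^1=274668$. For $n=2$: $s_1^2=1$, $s_2^2=1$, $s_3^2=2$, $s_4^2=5$, $s_5^2=34$, $s_6^2=2136$, $s_7^2=7013320$, $s_8^2=1788782616656$, $s_9^2=53304527811667897248$. For $n=3$: $s_1^3=1$, $s_2^3=1$, $s_3^3=1$, $s_4^3=2$, $s_5^3=6$, $s_6^3=156$, $s_7^3=7013320$, $s_8^3=29281354514767168$, $s_9^3=234431745534048922731115555415680$.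
   Context: An $n$-plex of order $p$ is a simplicial complex with $p$ points (vertices) in which every maximal simplex (a simplex that is not a face of any larger simplex) has dimension $n$ or $0$; the complex consisting of the $p$ points only, with no simplex of dimension $n$, is included in the count. Such a complex is determined by its set of $n$-dimensional simplexes, so an $n$-plex of order $p$ is the same thing as an $(n+1)$-uniform hypergraph on $p$ vertices, i.e. an arbitrary (possibly empty) set of $(n+1)$-element subsets of a $p$-element set. Two are isomorphic if some bijection of the vertex sets carries one family of subsets onto the other. Thus $s_p^n$ is the number of orbits of the symmetric group $S_p$ acting on the set of all families of $(n+1)$-element subsets of $\{1,\dots,p\}$. *)

(* Defs.v *)
From mathcomp Require Import all_boot all_fingroup.

Set Implicit Arguments.
Unset Strict Implicit.
Unset Printing Implicit Defensive.

(* A simplicial complex whose set of points is the whole of T, given by its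
   nonempty simplexes; a simplex F has dimension #|F| - 1. *)
Definition simplicial_complex (T : finType) (K : {set {set T}}) : bool :=
  [&& set0 \notin K,
      [forall x : T, [set x] \in K]
    & [forall F in K, forall G : {set T},
         (G != set0) && (G \subset F) ==> (G \in K)]].

(* Maximal simplexes have dimension n or 0, i.e., n.+1 elements or a single
   one. *)
Definition plex (T : finType) (n : nat) (K : {set {set T}}) : bool :=
  simplicial_complex K &&
  [forall F : {set T},
     maxset (mem K) F ==> ((#|F| == n.+1) || (#|F| == 1))].

Definition complex_iso (T : finType) (K L : {set {set T}}) : bool :=
  [exists s : {perm T}, [set s @: F | F : {set T} in K] == L].

Lemma complex_iso_equiv (T : finType) : equivalence_rel (@complex_iso T).
Proof.
have isoxx (K : {set {set T}}) : complex_iso K K.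
  apply/existsP; exists 1%g; apply/eqP; rewrite -[RHS]imset_id.
  apply: eq_imset => F; rewrite -[RHS]imset_id.
  by apply: eq_imset => x; rewrite perm1.
have isoT (K L M : {set {set T}}) :
    complex_iso K L -> complex_iso L M -> complex_iso K M.
  move=> /existsP[s /eqP <-] /existsP[t /eqP <-]; apply/existsP.
  exists (s * t)%g; apply/eqP; rewrite -imset_comp; apply: eq_imset => F /=.
  by rewrite -imset_comp; apply: eq_imset => x; rewrite permM.
have isoC (K L : {set {set T}}) : complex_iso K L -> complex_iso L K.
  move=> /existsP[s /eqP <-]; apply/existsP; exists (s^-1)%g; apply/eqP.
  rewrite -imset_comp -[RHS]imset_id; apply: eq_imset => F /=.
  rewrite -imset_comp -[RHS]imset_id; apply: eq_imset => x /=.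
  by rewrite permK.
move=> K L M; split=> [|KL]; first exact: isoxx.
by apply/idP/idP; [exact: (isoT _ _ _ (isoC _ _ KL)) | exact: (isoT _ _ _ KL)].
Qed.

Definition num_plexes (p n : nat) : nat :=
  #|equivalence_partition (@complex_iso 'I_p) [set K | plex n K]|.

(* Main.v *)
(** Burnside's lemma for ['S_p] acting on plexes. A plex is the downward closure
    of its set of (n+1)-point simplexes together with the points, so the plexes
    fixed by [s] correspond to the families of (n+1)-sets invariant under [s];
    there are [2 ^ c] of them, with [c] the number of orbits of [s] on
    (n+1)-sets.

    The sum over ['S_p] is computed from a table of conjugacy classes with their
    sizes, obtained by induction on [p]: every permutation of [p + 1] points
    arises exactly once from a permutation [t] of [p] points by inserting the
    new point before some [i] in its cycle (or as a fixed point), and conjugating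
    [t] conjugates the results. So it is enough to insert in one
    representative of each class, and to merge the results that have the same
    normal form. *)

Require Import Defs.
From Stdlib Require Import BinNat.
From mathcomp Require Import all_boot all_order all_fingroup.

Set Implicit Arguments.
Unset Strict Implicit.
Unset Printing Implicit Defensive.

Import Order.TTheory.

(** * Plexes and families of facets *)

Section Plexes.
Variables (T : finType) (n : nat).
Hypothesis n_gt0 : 0 < n.

Definition facets : {set {set T}} := [set F : {set T} | #|F| == n.+1].

(** Singletons are put in outright, so that the empty family yields the complex of the points
    only. *)
Definition facet_closure (E : {set {set T}}) : {set {set T}} :=
  [set F : {set T} | (#|F| == 1) || (F != set0) && [exists G in E, F \subset G]].

(** As [n > 0], no singleton is a facet, and a facet contained in another equals it by
    cardinality. *)
Lemma facet_closureK (E : {set {set T}}) :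
  E \subset facets -> facet_closure E :&: facets = E.
Proof.
move=> /subsetP sE; apply/setP=> F; rewrite !inE.
apply/andP/idP => [[/orP[/eqP->|/andP[_ /exists_inP[G GE sFG]]] cF]|FE].
- by rewrite eqSS eq_sym (gtn_eqF n_gt0) in cF.
- have := sE G GE; rewrite inE => /eqP cG.
  suff -> : F = G by [].
  by apply/eqP; rewrite eqEcard sFG cG (eqP cF) leqnn.
- have := sE F FE; rewrite inE => cF; split=> //; apply/orP; right.
  rewrite -card_gt0 (eqP cF) /=; by apply/exists_inP; exists F; rewrite ?subxx.
Qed.

Lemma plex_closure (E : {set {set T}}) :
  E \subset facets -> plex n (facet_closure E).
Proof.
move=> /subsetP sE; apply/andP; split.
  apply/and3P; split.
  - by rewrite !inE cards0 eqxx.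
  - by apply/forallP=> x; rewrite inE cards1.
  - apply/forall_inP=> F; rewrite inE => FK; apply/forallP=> G.
    apply/implyP=> /andP[G0 sGF]; rewrite inE G0 /=.
    case/orP: FK => [cF|/andP[_ /exists_inP[H HE sFH]]].
      by rewrite eqn_leq card_gt0 G0 -(eqP cF) subset_leq_card.
    by apply/orP; right; apply/exists_inP; exists H => //; apply: subset_trans sFH.
apply/forallP=> F; apply/implyP=> /maxsetP[/=]; rewrite inE.
case/orP=> [-> _|/andP[F0 /exists_inP[G GE sFG]] maxF]; first by rewrite orbT.
have cG := sE G GE; rewrite inE in cG.
rewrite -(maxF G) ?cG // inE -card_gt0 (eqP cG) /=.
by apply/orP; right; apply/exists_inP; exists G.
Qed.

(** A simplex lies in a maximal one, which is a facet or a single point; in the latter case the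
    simplex is that point. *)
Lemma closure_facets (K : {set {set T}}) :
  plex n K -> facet_closure (K :&: facets) = K.
Proof.
case/andP=> /and3P[K0 /forallP K1 /forall_inP Kdown] /forallP Kmax.
apply/setP=> F; rewrite inE; apply/idP/idP.
  case/orP=> [/cards1P[x ->] //|/andP[F0 /exists_inP[G]]].
  rewrite inE => /andP[GK _] sFG.
  by have /forallP/(_ F)/implyP := Kdown G GK; rewrite F0 sFG; apply.
move=> FK; have [G maxG sFG] := @maxset_exists _ (mem K) F FK.
have F0 : F != set0 by apply: contraNneq K0 => <-.
have := Kmax G; rewrite maxG /= => /orP[] cG; last first.
  by rewrite eqn_leq card_gt0 F0 -(eqP cG) subset_leq_card.
apply/orP; right; rewrite F0; apply/exists_inP; exists G => //.
by rewrite !inE cG; case/maxsetP: maxG => /= ->.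
Qed.

(** Equivariance of the closure: it allows the plexes fixed by [s] to be counted as invariant
    families. *)
Lemma closure_imset (s : {perm T}) (E : {set {set T}}) :
  facet_closure [set s @: F | F : {set T} in E]
    = [set s @: F | F : {set T} in facet_closure E].
Proof.
have im_inj : injective (fun F : {set T} => s @: F) := imset_inj (@perm_inj _ s).
have sK (F : {set T}) : s @: (s @^-1: F) = F.
  by apply/setP=> x; apply/imsetP/idP=> [[y + ->]|xF]; rewrite ?inE //;
     exists (s^-1 x)%g; rewrite ?inE permKV.
apply/setP=> F; rewrite -(sK F) (mem_imset _ _ im_inj) !inE.
rewrite card_imset; last exact: perm_inj.
rewrite imset_eq0; congr (_ || _ && _); rewrite sK.
apply/exists_inP/exists_inP => [[_ /imsetP[G GE ->]]|[G GE sFG]].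
  move=> sFG; exists G => //; apply/subsetP=> x; rewrite inE => xF.
  by rewrite -(mem_imset _ _ (@perm_inj _ s)) (subsetP sFG).
exists (s @: G); first exact: imset_f.
by rewrite -(sK F) imsetS.
Qed.

Lemma facets_imset (s : {perm T}) (E : {set {set T}}) :
  E \subset facets -> [set s @: F | F : {set T} in E] \subset facets.
Proof.
move=> /subsetP sE; apply/subsetP=> _ /imsetP[F /sE + ->].
by rewrite !inE card_imset //; apply: perm_inj.
Qed.

Lemma plexes_closure : [set K | plex n K] = facet_closure @: powerset facets.
Proof.
apply/setP=> K; rewrite inE; apply/idP/imsetP=> [Kp|[E + ->]].
  by exists (K :&: facets); rewrite ?closure_facets // inE subsetIr.
by rewrite inE; apply: plex_closure.
Qed.

(** * Burnside's lemma, transferred to families of facets *)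

Definition invariant_families (s : {perm T}) : {set {set {set T}}} :=
  [set E in powerset facets | [set s @: F | F : {set T} in E] == E].

(** Isomorphism classes are orbits of the symmetric group, and [facet_closure] is an equivariant
    bijection from families of facets to plexes. *)
Lemma plex_Burnside :
  #|equivalence_partition (@complex_iso T) [set K | plex n K]| * #|T|`!
    = \sum_(s : {perm T}) #|invariant_families s|.
Proof.
(* The action on points, lifted to sets and then to sets of sets. *)
pose to := ('P^*^*)%act : {action {perm T} &-> {set {set T}}}.
have toE K s : to K s = [set s @: F | F : {set T} in K] by [].
have clI : {in powerset facets &, injective facet_closure}.
  move=> E E'; rewrite !inE => /facet_closureK {2}<- /facet_closureK {2}<-.
  by move->.
have actsS : [acts [set: {perm T}], on [set K | plex n K] | to].
  apply/subsetP=> s _; rewrite inE in_setT inE; apply/subsetP=> K.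
  rewrite plexes_closure => /imsetP[E]; rewrite !inE => sE ->.
  by rewrite toE -closure_imset; apply: imset_f; rewrite inE facets_imset.
transitivity (#|orbit to [set: {perm T}] @: [set K | plex n K]|
              * #|[set: {perm T}]|)%N.
  congr (_ * _)%N; last first.
    rewrite -(cardsT T) -card_perm cardsT.
    by apply: eq_card => s; rewrite unfold_in; apply/subsetP=> x; rewrite inE.
  congr #|pred_of_set _|; apply: eq_in_imset => K KS.
  apply/setP=> L; rewrite inE; apply/andP/orbitP=> [[_ /existsP[s /eqP <-]]|[s _ <-]].
    by exists s; rewrite ?inE.
  rewrite (acts_act actsS) ?inE // in KS *; split=> //.
  by apply/existsP; exists s; rewrite toE.
rewrite -Frobenius_Cauchy //; apply: eq_big => [s|s _]; first by rewrite inE.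
rewrite -(card_in_imset (f := facet_closure) (D := invariant_families s)); last first.
  by move=> E E'; rewrite inE => /andP[sE _]; rewrite inE => /andP[sE' _]; apply: clI.
congr #|pred_of_set _|; apply/setP=> K; rewrite in_setI plexes_closure.
apply/andP/imsetP=> [[/imsetP[E sE ->] /afix1P]|[E]].
  rewrite toE -closure_imset => eqE; exists E => //; rewrite inE sE /=.
  by apply/eqP/clI => //; move: sE; rewrite !inE; apply: facets_imset.
rewrite inE => /andP[sE /eqP eqE] ->; split; first exact: imset_f.
by apply/afix1P; rewrite toE -closure_imset eqE.
Qed.
End Plexes.

(** * Families invariant under an injection *)

Section Leaders.
Variables (d : Order.disp_t) (R : orderType d) (T : finType).
Variables (f : T -> T) (r : T -> R) (D : {set T}).
Hypotheses (f_inj : injective f) (r_inj : injective r).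
Hypothesis fD : forall x, (f x \in D) = (x \in D).

(** One representative for each orbit of [f] in [D]: the member of least rank [r]. *)
Definition leaders : {set T} :=
  [set x in D | [forall y, fconnect f x y ==> (r x <= r y)%O]].

(** An invariant subset is a union of orbits, so it is determined by the leaders it contains, and
    these can be chosen freely. *)
Lemma card_invariant :
  #|[set E in powerset D | [forall x, (f x \in E) == (x \in E)]]| = 2 ^ #|leaders|.
Proof.
pose lead x := [arg min_(y < x | fconnect f x y) r y]%O.
have leadP x : fconnect f x (lead x) /\ forall y, fconnect f x y -> (r (lead x) <= r y)%O.
  rewrite /lead; case: arg_minP => [|y xy ymin]; first exact: connect0.
  by split.
have closedI (E : {set T}) : (forall x, (f x \in E) = (x \in E)) ->
    forall x, (lead x \in E) = (x \in E).
  move=> fE x; have [xl _] := leadP x; apply/esym.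
  by apply: (closed_connect _ xl) => y _ /eqP <-; rewrite fE.
have lead_f x : lead (f x) = lead x.
  have [cx minx] := leadP x; have [cfx minfx] := leadP (f x).
  apply/r_inj/le_anti/andP; split.
    by apply: minfx; rewrite -same_fconnect1.
  by apply: minx; rewrite (same_fconnect1 f_inj).
have lead_id x : x \in leaders -> lead x = x.
  rewrite inE => /andP[_ /forallP minx]; have [cx leadx] := leadP x.
  apply/r_inj/le_anti; rewrite leadx ?connect0 //=.
  by have := minx (lead x); rewrite cx.
have leadL x : x \in D -> lead x \in leaders.
  move=> xD; rewrite inE closedI // xD; apply/forallP=> y; apply/implyP=> cy.
  have [cx minx] := leadP x; apply: minx; exact: connect_trans cy.
rewrite -card_powerset -(card_in_imset (f := fun E => E :&: leaders)).
  congr #|pred_of_set _|; apply/setP=> M; rewrite powersetE.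
  apply/imsetP/idP=> [[E _ ->]|/subsetP sM]; first exact: subsetIr.
  (* The union of the orbits whose leader is in [M]. *)
  exists [set x in D | lead x \in M].
    rewrite !inE; apply/andP; split.
      by apply/subsetP=> x; rewrite inE => /andP[].
    by apply/forallP=> x; rewrite !inE fD lead_f.
  apply/setP=> x; rewrite in_setI inE; apply/idP/andP=> [xM|[/andP[_ + xL]]].
    have xL := sM x xM; rewrite lead_id // xM xL.
    by move: xL; rewrite inE => /andP[->].
  by rewrite lead_id.
move=> E E'; rewrite !inE.
move=> /andP[/subsetP sE /forallP fE] /andP[/subsetP sE' /forallP fE'] eqL.
have leadE (F : {set T}) : (forall x, (f x \in F) == (x \in F)) ->
    forall x, (lead x \in F) = (x \in F).
  by move=> fF; apply: closedI => x; apply/eqP.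
apply/setP=> x; apply/idP/idP=> xE.
  have : lead x \in E :&: leaders by rewrite inE leadE // xE leadL ?sE.
  by rewrite eqL inE leadE // => /andP[].
have : lead x \in E' :&: leaders by rewrite inE leadE // xE leadL ?sE'.
by rewrite -eqL inE leadE // => /andP[].
Qed.
End Leaders.

(** * Orbits computed from the one-line notation *)

Definition one_line (p : nat) (s : 'S_p) : seq nat := [seq val (s i) | i <- enum 'I_p].

Lemma size_one_line (p : nat) (s : 'S_p) : size (one_line s) = p.
Proof. by rewrite size_map size_enum_ord. Qed.

Lemma nth_one_line (p : nat) (s : 'S_p) (i : 'I_p) : nth 0 (one_line s) i = s i.
Proof. by rewrite (nth_map i) ?size_enum_ord ?nth_ord_enum. Qed.

Lemma one_line_perm_eq (p : nat) (s : 'S_p) : perm_eq (one_line s) (iota 0 p).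
Proof.
apply: uniq_perm; rewrite ?iota_uniq //.
  by rewrite map_inj_uniq ?enum_uniq // => i j /val_inj/perm_inj.
move=> k; rewrite mem_iota add0n /=; apply/mapP/idP=> [[i _ ->]|k_lt]; first exact: ltn_ord.
by exists ((s^-1)%g (Ordinal k_lt)); rewrite ?mem_enum ?permKV.
Qed.

Lemma one_lineP (p : nat) (l : seq nat) :
  reflect (exists s : 'S_p, l = one_line s) (perm_eq l (iota 0 p)).
Proof.
apply: (iffP idP) => [l_perm|[s ->]]; last exact: one_line_perm_eq.
have size_l : size l = p by rewrite (perm_size l_perm) size_iota.
have l_uniq : uniq l by rewrite (perm_uniq l_perm) iota_uniq.
have l_lt (i : 'I_p) : nth 0 l i < p.
  have : nth 0 l i \in l by rewrite mem_nth ?size_l.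
  by rewrite (perm_mem l_perm) mem_iota.
pose f i := Ordinal (l_lt i).
have f_inj : injective f.
  by move=> i j [] /eqP; rewrite nth_uniq ?size_l // => /eqP/val_inj.
exists (perm f_inj); apply: (@eq_from_nth _ 0); rewrite ?size_one_line // size_l.
by move=> i i_lt; rewrite (nth_one_line _ (Ordinal i_lt)) permE.
Qed.

Section CountOrbits.

(** The type [seqlexi] provides the lexicographic order, which serves as the rank of subsets in
    [leaders]. *)
Definition indicator (p : nat) (A : {set 'I_p}) : seqlexi bool :=
  [seq i \in A | i <- enum 'I_p].

Definition pull (l : seq nat) (m : bitseq) : bitseq := [seq nth false m i | i <- l].

Fixpoint bitseqs (p : nat) : seq bitseq :=
  if p is p'.+1 then [seq b :: m | b <- [:: true; false], m <- bitseqs p']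
  else [:: [::]].

(* Nested [if]s rather than [||] and [&&], whose second argument [vm_compute]
   would always evaluate. *)
Fixpoint least_in_orbit (l : seq nat) (N : nat) (x y : bitseq) : bool :=
  if N is N'.+1 then
    if y == x then true
    else if ((x : seqlexi bool) <= (y : seqlexi bool))%O then
      least_in_orbit l N' x (pull l y)
    else false
  else true.

(** Each orbit on [k]-subsets is counted at its lexicographically least member. The fuel [size U] is
    the number of all subsets, which bounds every orbit length. *)
Definition count_orbits (l : seq nat) (k : nat) : nat :=
  let U := bitseqs (size l) in
  count (fun x => (count id x == k) && least_in_orbit l (size U) x (pull l x)) U.

Variables (p : nat) (s : 'S_p).
(** Preimages replace images: their indicators are read off the one-line notation without inverting
    [s], and the invariant families are the same. *)
Let f (A : {set 'I_p}) : {set 'I_p} := s @^-1: A.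
Let f_inj : injective f.
Proof.
move=> A B /setP eqAB; apply/setP=> x.
by have := eqAB ((s^-1)%g x); rewrite !inE permKV.
Qed.

Lemma nth_indicator (A : {set 'I_p}) (i : 'I_p) :
  nth false (indicator A) i = (i \in A).
Proof. by rewrite (nth_map i) ?size_enum_ord ?nth_ord_enum. Qed.

Lemma indicator_inj : injective (@indicator p).
Proof.
by move=> A B eqAB; apply/setP=> i; rewrite -!nth_indicator eqAB.
Qed.

Lemma count_indicator (A : {set 'I_p}) : count id (indicator A) = #|A|.
Proof.
rewrite count_map cardE /enum_mem size_filter count_filter.
by rewrite -enumT; apply: eq_count => i /=; rewrite andbT.
Qed.

Lemma indicator_preim (A : {set 'I_p}) :
  indicator (f A) = pull (one_line s) (indicator A).
Proof.
by rewrite /pull -map_comp; apply: eq_map => i /=; rewrite nth_indicator inE.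
Qed.

Lemma mem_bitseqs (q : nat) (m : bitseq) : (m \in bitseqs q) = (size m == q).
Proof.
elim: q m => [|q IHq] m; first by case: m.
apply/allpairsP/idP=> [[[b m'] [_ + ->]]|] /=; first by rewrite IHq.
by case: m => //= b m; rewrite eqSS -IHq => m_in; exists (b, m); split=> //; case: b.
Qed.

Lemma bitseqs_uniq (q : nat) : uniq (bitseqs q).
Proof.
elim: q => // q IHq; apply: allpairs_uniq => //.
by move=> [b m] [c m'] _ _ /= [-> ->].
Qed.

Lemma perm_eq_bitseqs :
  perm_eq [seq (indicator A : bitseq) | A <- enum {set 'I_p}] (bitseqs p).
Proof.
apply: uniq_perm; rewrite ?bitseqs_uniq //.
  by rewrite map_inj_uniq ?enum_uniq //; apply: indicator_inj.
move=> m; rewrite mem_bitseqs; apply/mapP/eqP=> [[A _ ->]|size_m].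
  by rewrite size_map size_enum_ord.
exists [set i : 'I_p | nth false m i]; first by rewrite mem_enum.
apply: (@eq_from_nth _ false) => [|i]; first by rewrite size_map size_enum_ord.
by rewrite size_m => i_lt; rewrite (nth_indicator _ (Ordinal i_lt)) inE.
Qed.

(** The loop tests the iterates of exponents 1 to [N], stopping early at a return to [A]; an orbit
    of at most [N.+1] members is covered entirely. *)
Lemma least_in_orbitP (A : {set 'I_p}) (N : nat) : fingraph.order f A <= N.+1 ->
  least_in_orbit (one_line s) N (indicator A) (pull (one_line s) (indicator A))
    = [forall B, fconnect f A B ==> (indicator A <= indicator B)%O].
Proof.
move=> le_ordN; rewrite -indicator_preim; apply/idP/forallP=> [leastA B|minA].
  apply/implyP=> cAB; rewrite -(iter_findex cAB).
  have [->|i_gt0] := posnP (findex f A B); first exact: lexx.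
  have i_lt := findex_max cAB.
  move: (findex f A B) i_gt0 i_lt => i i_gt0 i_lt.
  (* Here [j] is the exponent under test and [N'] the remaining fuel; as [0 < j <= i] lies below the
     order, the loop cannot have returned to [A] yet. *)
  suff least_iter (N' j : nat) : 0 < j -> j <= i -> fingraph.order f A <= j + N' ->
      least_in_orbit (one_line s) N' (indicator A) (indicator (iter j f A)) ->
      (indicator A <= indicator (iter i f A))%O.
    exact: (least_iter N 1).
  elim: N' j => [|N' IHN] j j_gt0 le_ji.
    by rewrite addn0 leqNgt (leq_ltn_trans le_ji).
  move=> le_ord /=; case: eqP => [/indicator_inj eqA _|_].
    have := findex_iter (leq_ltn_trans le_ji i_lt).
    by rewrite eqA findex0 => j0; rewrite -j0 in j_gt0.
  case: ifP => // le_j; rewrite -indicator_preim -iterS.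
  have [<- _ //|ne_ji] := eqVneq j i.
  by apply: IHN; rewrite ?addSnnS // ltn_neqAle ne_ji.
have {}minA i : (indicator A <= indicator (iter i f A))%O.
  by have := minA (iter i f A); rewrite fconnect_iter.
rewrite -[f A]/(iter 1 f A); elim: N 1 {le_ordN} => //= N IHN i.
by rewrite minA -indicator_preim -iterS IHN if_same.
Qed.

Lemma card_invariant_families (n : nat) :
  #|invariant_families n s| = 2 ^ count_orbits (one_line s) n.+1.
Proof.
have fD A : (f A \in facets 'I_p n) = (A \in facets 'I_p n).
  by rewrite !inE card_preimset //; apply: perm_inj.
transitivity (2 ^ #|leaders f (@indicator p) (facets 'I_p n)|).
  rewrite -(card_invariant f_inj indicator_inj fD).
  apply: eq_card => E; rewrite !inE; congr (_ && _).
  have imK A : s @: f A = A.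
    apply/setP=> x; apply/imsetP/idP=> [[y + ->]|xA]; first by rewrite inE.
    by exists ((s^-1)%g x); rewrite ?inE permKV.
  have im_inj : injective (fun F : {set 'I_p} => s @: F) := imset_inj (@perm_inj _ s).
  apply/eqP/forallP=> [eqE A|fE].
    by rewrite -{2}(imK A) -{2}eqE mem_imset.
  by apply/setP=> A; rewrite -(imK A) mem_imset // imK (eqP (fE A)).
congr (2 ^ _); rewrite /count_orbits size_one_line -(seq.permP perm_eq_bitseqs) count_map.
rewrite -sum1_card -sum1_count big_enum_cond; apply: eq_bigl => A /=.
rewrite !inE count_indicator; congr (_ && _); rewrite least_in_orbitP //.
rewrite -(perm_size perm_eq_bitseqs) size_map -cardE; apply/leqW.
exact: max_card.
Qed.
End CountOrbits.

(** * The table of conjugacy classes *)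

Section Insertion.
Variable p : nat.

Definition insert_perm (t : 'S_p) (i : 'I_p.+1) : 'S_p.+1 :=
  (lift_perm ord_max ord_max t * tperm ord_max i)%g.

(** For [i = size l] no entry is replaced and the new point is fixed. *)
Definition insert_line (l : seq nat) (i : nat) : seq nat :=
  rcons [seq if y == i then size l else y | y <- l] i.

Lemma insert_perm_max (t : 'S_p) (i : 'I_p.+1) : insert_perm t i ord_max = i.
Proof. by rewrite permM lift_perm_id tpermL. Qed.

Lemma insert_perm_lift (t : 'S_p) (i : 'I_p.+1) (k : 'I_p) :
  insert_perm t i (lift ord_max k)
    = if lift ord_max (t k) == i then ord_max else lift ord_max (t k).
Proof.
rewrite permM lift_perm_lift; case: tpermP => [/eqP|->|/eqP _ /eqP/negPf->] //.
  by rewrite eq_sym (negPf (neq_lift _ _)).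
by rewrite eqxx.
Qed.

Lemma one_line_insert (t : 'S_p) (i : 'I_p.+1) :
  one_line (insert_perm t i) = insert_line (one_line t) i.
Proof.
rewrite /insert_line size_one_line /one_line enum_ordSr map_rcons insert_perm_max.
congr rcons; rewrite -[LHS]map_comp -[RHS]map_comp; apply: eq_map => k /=.
have -> : widen_ord (leqnSn p) k = lift ord_max k by apply: ord_inj; rewrite lift_max.
rewrite insert_perm_lift -(inj_eq (@ord_inj _)) lift_max.
by case: eqP => // _; rewrite lift_max.
Qed.

(** The image of the new point gives back [i]; cancelling the transposition then gives back [t].
    Cardinals agree. *)
Lemma insert_perm_bij :
  bijective (fun x : 'S_p * 'I_p.+1 => insert_perm x.1 x.2).
Proof.
apply: inj_card_bij => [[t i] [u j] /= /permP eq_tu|].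
  have eq_ij : i = j by rewrite -(insert_perm_max t i) eq_tu insert_perm_max.
  rewrite eq_ij in eq_tu *; congr (_, _); apply/permP=> k; apply: (@lift_inj _ ord_max).
  rewrite -2!(lift_perm_lift ord_max); apply: (@perm_inj _ (tperm ord_max j)).
  by rewrite -!permM; apply: eq_tu.
by rewrite card_prod card_ord !card_Sn factS mulnC.
Qed.

Lemma sum_insert (F : 'S_p.+1 -> nat) :
  \sum_s F s = \sum_t \sum_i F (insert_perm t i).
Proof.
rewrite pair_big (reindex _ (onW_bij _ insert_perm_bij)) /=.
by apply: eq_big => [[t i]|].
Qed.

(** Extended to fix the new point, [u] carries the transposition with [i] to the one with the image
    of [i]. *)
Lemma insert_permJ (t u : 'S_p) (i : 'I_p.+1) :
  (insert_perm t i ^ lift_perm ord_max ord_max u)%g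
    = insert_perm (t ^ u)%g (lift_perm ord_max ord_max u i).
Proof.
rewrite conjMg tpermJ lift_perm_id; congr (_ * _)%g.
by rewrite /conjg lift_permV !lift_permM.
Qed.
End Insertion.

(** * Normal forms under conjugation and the merged table *)

Definition relabel (c l : seq nat) : seq nat := [seq index (nth 0 l x) c | x <- c].

(** The point [u i] is renamed [i], which is conjugation by the inverse of [u]. *)
Lemma relabel_one_line (p : nat) (s u : 'S_p) :
  relabel (one_line u) (one_line s) = one_line (s ^ (u^-1))%g.
Proof.
rewrite /relabel -map_comp; apply: eq_map => i /=.
rewrite nth_one_line conjgE invgK !permM.
set j := s (u i); rewrite -{1}(permKV u j) -nth_one_line index_uniq //.
  by rewrite size_one_line.
by rewrite (perm_uniq (one_line_perm_eq u)) iota_uniq.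
Qed.

(* Any list would do as relabelling; this one lists the cycles by increasing
   length, so that conjugate permutations get the same normal form. *)
Definition cycle_word (l : seq nat) : seq nat :=
  let cycle x := undup (traject (nth 0 l) x (size l)) in
  let heads := [seq x <- iota 0 (size l) | all (leq x) (cycle x)] in
  flatten (sort (fun c d => size c <= size d) [seq cycle x | x <- heads]).

(** The test guarantees a conjugate of the input whatever [cycle_word] returns, so nothing has to be
    proved about cycles. *)
Definition normalize (l : seq nat) : seq nat :=
  let c := cycle_word l in
  if perm_eq c (iota 0 (size l)) then relabel c l else l.

Lemma normalize_one_line (p : nat) (s : 'S_p) :
  exists u : 'S_p, normalize (one_line s) = one_line (s ^ u)%g.
Proof.
rewrite /normalize size_one_line; case: one_lineP => [[u ->]|_].
  by exists (u^-1)%g; rewrite relabel_one_line.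
by exists 1%g; rewrite conjg1.
Qed.

(** Only equal lists are merged; weighted sums stay correct even if conjugate entries remain
    apart. *)
Fixpoint add_entry (x : N * seq nat) (L : seq (N * seq nat)) : seq (N * seq nat) :=
  if L is y :: L' then
    if x.2 == y.2 then (N.add x.1 y.1, y.2) :: L' else y :: add_entry x L'
  else [:: x].

Definition insertions (p : nat) (L : seq (N * seq nat)) : seq (N * seq nat) :=
  [seq (x.1, normalize (insert_line x.2 i)) | x <- L, i <- iota 0 p].

(* Entry [(w, l)]: one conjugacy class of ['S_p], with its cardinal [w] and
   the one-line notation [l] of an element. *)
Fixpoint class_table (p : nat) : seq (N * seq nat) :=
  if p is p'.+1 then foldr add_entry [::] (insertions p (class_table p'))
  else [:: (1%num, [::])].

Lemma nat_of_add_bin (a b : N) : nat_of_bin (N.add a b) = a + b.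
Proof. by case: a b => [|a] [|b] //=; rewrite ?addn0 // nat_of_add_pos. Qed.

Lemma nat_of_mul_bin (a b : N) : nat_of_bin (N.mul a b) = a * b.
Proof. by case: a b => [|a] [|b] //=; rewrite ?muln0 // nat_of_mul_pos. Qed.

Lemma sum_add_entry (g : seq nat -> nat) (x : N * seq nat) (L : seq (N * seq nat)) :
  \sum_(y <- add_entry x L) nat_of_bin y.1 * g y.2
    = x.1 * g x.2 + \sum_(y <- L) nat_of_bin y.1 * g y.2.
Proof.
elim: L => [|y L IHL] /=; first by rewrite big_seq1 big_nil addn0.
case: eqP => [->|_]; rewrite !big_cons /=.
  by rewrite nat_of_add_bin mulnDl addnA.
by rewrite IHL addnCA.
Qed.

Lemma all_add_entry (P : pred (seq nat)) (x : N * seq nat) (L : seq (N * seq nat)) :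
  P x.2 -> all (fun y => P y.2) L -> all (fun y => P y.2) (add_entry x L).
Proof.
move=> Px; elim: L => [|y L IHL] /=; first by rewrite Px.
by case/andP=> Py PL; case: eqP => _ /=; rewrite Py ?PL ?IHL.
Qed.

Lemma class_table_perm (p : nat) :
  all (fun x => perm_eq x.2 (iota 0 p)) (class_table p).
Proof.
elim: p => [|p IHp] //=; set L := insertions _ _.
have : all (fun x => perm_eq x.2 (iota 0 p.+1)) L.
  apply/allP=> _ /allpairsP[[x i] [xT + ->]].
  rewrite mem_iota /= => i_lt; have /one_lineP[t ->] := allP IHp x xT.
  rewrite -[i]/(val (Ordinal i_lt)) -one_line_insert.
  have [u ->] := normalize_one_line (insert_perm t (Ordinal i_lt)).
  exact: one_line_perm_eq.
elim: L => [|x L IHL] //= /andP[Px PL].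
exact: (all_add_entry (P := fun l => perm_eq l (iota 0 p.+1)) Px (IHL PL)).
Qed.

(** Induction on [p]: summing a class function over all insertions into [t] gives a class function
    [h] of [t], to which the induction hypothesis applies. Normalizing only conjugates, so it
    preserves [g]. *)
Lemma sum_class_table (p : nat) (g : seq nat -> nat) :
  (forall s u : 'S_p, g (one_line (s ^ u)%g) = g (one_line s)) ->
  \sum_(s : 'S_p) g (one_line s) = \sum_(x <- class_table p) nat_of_bin x.1 * g x.2.
Proof.
elim: p g => [|p IHp] g gJ.
  rewrite /= big_seq1 mul1n (big_pred1 1%g) => [|s].
    by congr g; apply: size0nil; rewrite size_one_line.
  by apply/esym/eqP/permP=> -[].
rewrite /=; set L := insertions _ _.
have -> : \sum_(x <- foldr add_entry [::] L) nat_of_bin x.1 * g x.2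
    = \sum_(x <- L) nat_of_bin x.1 * g x.2.
  by elim: L => //= x L IHL; rewrite sum_add_entry IHL big_cons.
pose h l := \sum_(i < p.+1) g (insert_line l i).
have h_line (t : 'S_p) : h (one_line t) = \sum_i g (one_line (insert_perm t i)).
  by apply: eq_bigr => i _; rewrite one_line_insert.
rewrite sum_insert -(eq_bigr _ (fun t _ => h_line t)) IHp => [|t u].
  rewrite big_allpairs_dep big_seq [RHS]big_seq; apply: eq_bigr => x xT.
  have /one_lineP[t def_t] := allP (class_table_perm p) x xT.
  rewrite /h big_distrr -[iota 0 p.+1]/(index_iota 0 p.+1) big_mkord.
  apply: eq_bigr => i _; congr (_ * _); rewrite def_t -one_line_insert.
  by have [u ->] := normalize_one_line (insert_perm t i); rewrite gJ.
(* Moving the insertion place along [u] turns the insertions into [t ^ u] into conjugates of those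
   into [t]. *)
rewrite !h_line (reindex_inj (@perm_inj _ (lift_perm ord_max ord_max u))).
by apply: eq_bigr => i _; rewrite -insert_permJ gJ.
Qed.

(** * The Burnside sum in binary arithmetic *)

Definition pow2_bin (c : nat) : N := iter c N.double 1%num.

Lemma nat_of_pow2_bin (c : nat) : nat_of_bin (pow2_bin c) = 2 ^ c.
Proof.
elim: c => //= c IHc; rewrite expnS -IHc.
by case: (pow2_bin c) => //= q; rewrite NatTrec.doubleE mul2n.
Qed.

Fixpoint fact_bin (p : nat) : N :=
  if p is p'.+1 then N.mul (bin_of_nat p) (fact_bin p') else 1%num.

Lemma nat_of_fact_bin (p : nat) : nat_of_bin (fact_bin p) = p`!.
Proof. by elim: p => // p IHp; rewrite [LHS]nat_of_mul_bin bin_of_natK IHp factS. Qed.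

Definition burnside_sum (p k : nat) : N :=
  foldr (fun x acc => N.add (N.mul x.1 (pow2_bin (count_orbits x.2 k))) acc)
    0%num (class_table p).

Lemma nat_of_burnside_sum (p k : nat) :
  nat_of_bin (burnside_sum p k)
    = \sum_(x <- class_table p) nat_of_bin x.1 * 2 ^ count_orbits x.2 k.
Proof.
rewrite /burnside_sum; elim: (class_table p) => [|x L IHL]; first by rewrite big_nil.
by rewrite big_cons /= nat_of_add_bin nat_of_mul_bin nat_of_pow2_bin IHL.
Qed.

(** The action of [u] maps the families invariant under [s] onto those invariant under [s ^ u]. This
    supplies the class-function hypothesis of [sum_class_table]. *)
Lemma card_invariant_familiesJ (T : finType) (n : nat) (s u : {perm T}) :
  #|invariant_families n (s ^ u)%g| = #|invariant_families n s|.
Proof.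
pose act_set (v : {perm T}) (E : {set {set T}}) := [set v @: F | F : {set T} in E].
have act_setM v w E : act_set w (act_set v E) = act_set (v * w)%g E.
  rewrite /act_set -imset_comp; apply: eq_imset => F /=.
  by rewrite -imset_comp; apply: eq_imset => x; rewrite permM.
have act_set_inj v : injective (act_set v).
  by apply: imset_inj; apply: imset_inj; apply: perm_inj.
rewrite -[RHS](card_imset _ (act_set_inj u)); congr #|pred_of_set _|.
have conj_fix v w E : E \in invariant_families n v ->
    act_set w E \in invariant_families n (v ^ w)%g.
  rewrite !inE => /andP[sE /eqP fixE]; rewrite facets_imset //=.
  by rewrite -/(act_set _ _) act_setM -conjgC -act_setM [act_set v E]fixE.
apply/setP=> E; apply/idP/imsetP=> [fixE|[E' + ->]]; last exact: conj_fix.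
exists (act_set (u^-1)%g E); first by rewrite -(conjgK u s); apply: conj_fix.
rewrite act_setM mulVg -[LHS]imset_id; apply: eq_imset => F.
by rewrite -[LHS]imset_id; apply: eq_imset => x; rewrite perm1.
Qed.

Lemma num_plexes_Burnside (p n : nat) : 0 < n ->
  num_plexes p n * p`! = burnside_sum p n.+1.
Proof.
move=> n_gt0; rewrite nat_of_burnside_sum -{2}(card_ord p) plex_Burnside //.
rewrite -(@sum_class_table p (fun l => 2 ^ count_orbits l n.+1)) => [|s u].
  by apply: eq_bigr => s _; apply: card_invariant_families.
by rewrite -!card_invariant_families card_invariant_familiesJ.
Qed.

(** Cancelling the positive factor [p]! avoids a division: a proposed value is checked by one
    product in binary. *)
Lemma num_plexes_eq (p n : nat) (v : N) : 0 < n ->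
  burnside_sum p n.+1 = N.mul v (fact_bin p) -> num_plexes p n = v.
Proof.
move=> n_gt0 sum_v; apply/eqP; rewrite -(eqn_pmul2r (fact_gt0 p)).
by rewrite num_plexes_Burnside // sum_v nat_of_mul_bin nat_of_fact_bin.
Qed.

Theorem mainTheorem1 :
  (num_plexes 1 1 = 1 /\
   num_plexes 2 1 = 2 /\
   num_plexes 3 1 = 4 /\
   num_plexes 4 1 = 11 /\
   num_plexes 5 1 = 34 /\
   num_plexes 6 1 = 156 /\
   num_plexes 7 1 = 1044 /\
   num_plexes 8 1 = 12346%num /\
   num_plexes 9 1 = 274668%num) /\
  (num_plexes 1 2 = 1 /\
   num_plexes 2 2 = 1 /\
   num_plexes 3 2 = 2 /\
   num_plexes 4 2 = 5 /\
   num_plexes 5 2 = 34 /\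
   num_plexes 6 2 = 2136 /\
   num_plexes 7 2 = 7013320%num /\
   num_plexes 8 2 = 1788782616656%num /\
   num_plexes 9 2 = 53304527811667897248%num) /\
  (num_plexes 1 3 = 1 /\
   num_plexes 2 3 = 1 /\
   num_plexes 3 3 = 1 /\
   num_plexes 4 3 = 2 /\
   num_plexes 5 3 = 6 /\
   num_plexes 6 3 = 156 /\
   num_plexes 7 3 = 7013320%num /\
   num_plexes 8 3 = 29281354514767168%num /\
   num_plexes 9 3 = 234431745534048922731115555415680%num).
Proof.
(* Values written in unary are first converted to binary; each equation is then an evaluation of the
   Burnside sum. *)
repeat match goal with |- _ /\ _ => split end;
  lazymatch goal with
  | |- num_plexes ?p ?n = nat_of_bin ?v => refine (@num_plexes_eq p n v isT _)
  | |- num_plexes ?p ?n = ?v =>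
      let b := eval vm_compute in (bin_of_nat v) in
      refine (@num_plexes_eq p n b isT _)
  end; vm_compute; reflexivity.
Qed.
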